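(* Let $(\mathcal X,\mathcal A,c,d,P,x_0,d_0)$ be a finite transient constrained Markov decision process (CMDP), let $\pi_B\in\Delta$ be a feasible baseline policy, let $\pi^*$ be an optimal policy of problem $\mathcal{OPT}$, and let $\epsilon^*$ and $L_{\epsilon^*}$ be the auxiliary cost and Lyapunov function candidate built from $\pi_B$ and $\pi^*$ (all defined in the context). Suppose $\pi_B$ satisfies $$\max_{x\in\mathcal X'}\epsilon^*(x)\le D_{\max}\cdot\min\left\{\frac{d_0-\mathcal D_{\pi_B}(x_0)}{\overline{\mathrm T}D_{\max}},\ \frac{\overline{\mathrm T}D_{\max}-\overline{\mathcal D}}{\overline{\mathrm T}D_{\max}+\overline{\mathcal D}}\right\},\qquad \overline{\mathcal D}=\max_{x\in\mathcal X'}\max_{\pi\in\Delta}\mathcal D_\pi(x).$$ Then, on top of the properties $$L_{\epsilon^*}(x)\ge T_{\pi_B,d}[L_{\epsilon^*}](x),\qquad L_{\epsilon^*}(x)\ge\max\{\mathcal D_{\pi^*}(x),\mathcal D_{\pi_B}(x)\}\ge 0,\qquad\forall x\in\mathcal X',$$ the function $L_{\epsilon^*}$ also satisfies $$L_{\epsilon^*}(x)\ge T_{\pi^*,d}[L_{\epsilon^*}](x)\quad\forall x\in\mathcal X',\qquad L_{\epsilon^*}(x_0)\le d_0,$$ and therefore the induced set of policies $\mathcal F_{L_{\epsilon^*}}$ contains an optimal policy of $\mathcal{OPT}$; that is, there is an optimal policy $\pi$ of $\mathcal{OPT}$ with $\pi(\cdot|x)\in\mathcal F_{L_{\epsilon^*}}(x)$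 for all $x\in\mathcal X'$.
   Context: CMDP. $\mathcal X=\mathcal X'\cup\{x_{\text{Term}}\}$ is a finite state space with transient states $\mathcal X'$ and a terminal state $x_{\text{Term}}\notin\mathcal X'$; $\mathcal A$ is a finite action set; $c(x,a)\in[0,C_{\max}]$ is the immediate cost; $d(x)\in[0,D_{\max}]$ is the immediate constraint cost, with $D_{\max}>0$; $P(\cdot|x,a)$ is the transition probability; $x_0\in\mathcal X'$ is the initial state; $d_0\ge 0$ is the constraint threshold. $\Delta$ is the set of Markov stationary (randomized) policies and $\Delta(x)$ the set of probability distributions $\pi(\cdot|x)$ on $\mathcal A$. $\mathrm T^*$ is the first hitting time of $x_{\text{Term}}$. Standing assumption (transience): $\mathrm T^*\le\overline{\mathrm T}$ for a constant $\overline{\mathrm T}$, uniformly over policies and initial states. Value functions and problem. $\mathcal C_\pi(x)=\mathbb E[\sum_{t=0}^{\mathrm T^*-1}c(x_t,a_t)\mid x_0=x,\pi]$ and $\mathcal D_\pi(x)=\mathbb E[\sum_{t=0}^{\mathrm T^*-1}d(x_t)\mid x_0=x,\pi]$. Problem $\mathcal{OPT}$: $\min_{\pi\in\Delta}\{\mathcal C_\pi(x_0):\mathcal D_\pi(x_0)\le d_0\}$. A policy is feasible if $\mathcal D_\pi(x_0)\le d_0$, and $\pi^*$ denotes an optimal policy in $\Delta$. Bellman operator. For $\pi\in\Delta$, a cost function $h$ and $x\in\mathcal X'$: $T_{\pi,h}[V](x)=\sum_a\pi(a|x)\big[h(x,a)+\sum_{x'\in\mathcal X'}P(x'|x,a)V(x')\big]$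 (a cost depending only on $x$ is viewed as a function of $(x,a)$). Lyapunov candidate. $D_{TV}(\pi^*\|\pi_B)(x)=\frac12\sum_{a}|\pi_B(a|x)-\pi^*(a|x)|$; $\epsilon^*(x)=2\overline{\mathrm T}D_{\max}D_{TV}(\pi^*\|\pi_B)(x)$ for $x\in\mathcal X'$; $L_{\epsilon^*}(x)=\mathbb E[\sum_{t=0}^{\mathrm T^*-1}(d(x_t)+\epsilon^*(x_t))\mid x_0=x,\pi_B]$ for $x\in\mathcal X'$, and $L_{\epsilon^*}(x_{\text{Term}})=0$. Induced policies. For $L:\mathcal X\to\mathbb R_{\ge0}$ and $x\in\mathcal X'$: $\mathcal F_L(x)=\{\pi(\cdot|x)\in\Delta(x):T_{\pi,d}[L](x)\le L(x)\}$. *)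

(* Defs.v *)
From HB Require Import structures.
From mathcomp Require Import all_boot all_order all_algebra.
From mathcomp Require Import all_classical all_reals all_analysis.
Set Implicit Arguments.
Unset Strict Implicit.
Unset Printing Implicit Defensive.
Import Order.TTheory GRing.Theory Num.Theory.
Import numFieldNormedType.Exports.
Local Open Scope classical_set_scope.
Local Open Scope ring_scope.

Definition is_dist (R : realType) (T : finType) (p : T -> R) : Prop :=
  (forall t, 0 <= p t) /\ \sum_(t : T) p t = 1.

(* The transient states are the [x != xterm].  The behaviour of the terminal
   state under [trans] is left free: everything stops at the first visit. *)
Record cmdp (R : realType) (X A : finType) := Cmdp {
  xterm : X;
  xinit : X;
  cost : X -> A -> R;
  ccost : X -> R;
  trans : X -> A -> X -> R;
  threshold : R;
  Cmax : R;
  Dmax : R;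
  xinit_transient : xinit != xterm;
  trans_dist : forall x a, is_dist (trans x a);
  cost_bounds : forall x a, 0 <= cost x a <= Cmax;
  ccost_bounds : forall x, 0 <= ccost x <= Dmax;
  Dmax_gt0 : 0 < Dmax;
  threshold_ge0 : 0 <= threshold }.

(* Markov stationary randomized policies; [pi x a] is pi(a|x). *)
Definition policies (R : realType) (X A : finType) : set (X -> A -> R) :=
  [set pi | forall x, is_dist (pi x)].

(* The first n steps of a trajectory started at x are encoded by
   w = ((a_0, x_1), (a_1, x_2), ..., (a_{n-1}, x_n)), with x_0 = x. *)
Definition state_at (X A : finType) (x : X) (n : nat)
    (w : n.-tuple (A * X)) (t : nat) : X :=
  nth x (x :: unzip2 w) t.

Definition traj_prob (R : realType) (X A : finType) (M : cmdp R X A)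
    (pi : X -> A -> R) (x : X) (n : nat) (w : n.-tuple (A * X)) : R :=
  \prod_(t < n) (pi (state_at x w t) (tnth w t).1
                 * trans M (state_at x w t) (tnth w t).1 (tnth w t).2).

Definition traj_expect (R : realType) (X A : finType) (M : cmdp R X A)
    (pi : X -> A -> R) (x : X) (n : nat) (f : n.-tuple (A * X) -> R) : R :=
  \sum_(w : n.-tuple (A * X)) traj_prob M pi x w * f w.

(* First index t <= n with x_t = xterm, and n + 1 if there is none. *)
Definition hitting_time (R : realType) (X A : finType) (M : cmdp R X A)
    (x : X) (n : nat) (w : n.-tuple (A * X)) : nat :=
  index (xterm M) (x :: unzip2 w).

(* T* <= Tbar almost surely, under every policy and from every initial state:
   a trajectory prefix of length n >= Tbar decides whether T* <= Tbar. *)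
Definition transient_within (R : realType) (X A : finType) (M : cmdp R X A)
    (Tbar : R) : Prop :=
  forall (pi : X -> A -> R) (x : X) (n : nat) (w : n.-tuple (A * X)),
    policies pi -> x != xterm M -> Tbar <= n%:R ->
    0 < traj_prob M pi x w -> (hitting_time M x w)%:R <= Tbar.

(* E[sum_{t < min(T*, n)} h(x_t, a_t) | x_0 = x, pi]. *)
Definition truncated_return (R : realType) (X A : finType) (M : cmdp R X A)
    (pi : X -> A -> R) (h : X -> A -> R) (x : X) (n : nat) : R :=
  traj_expect M pi x (fun w : n.-tuple (A * X) =>
    \sum_(t < n | (t < hitting_time M x w)%N)
      h (state_at x w t) (tnth w t).1).

(* E[sum_{t < T*} h(x_t, a_t) | x_0 = x, pi].  If T* is bounded by Tbar, the
   truncated returns equal this expectation exactly for all n >= Tbar; the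
   limit only removes the dependence on a choice of n. *)
Definition value (R : realType) (X A : finType) (M : cmdp R X A)
    (pi : X -> A -> R) (h : X -> A -> R) (x : X) : R :=
  limn (truncated_return M pi h x).

Definition cost_value (R : realType) (X A : finType) (M : cmdp R X A)
    (pi : X -> A -> R) (x : X) : R :=
  value M pi (cost M) x.

Definition constraint_value (R : realType) (X A : finType) (M : cmdp R X A)
    (pi : X -> A -> R) (x : X) : R :=
  value M pi (fun y _ => ccost M y) x.

Definition feasible (R : realType) (X A : finType) (M : cmdp R X A)
    (pi : X -> A -> R) : Prop :=
  policies pi /\ constraint_value M pi (xinit M) <= threshold M.

Definition optimal (R : realType) (X A : finType) (M : cmdp R X A)
    (pi : X -> A -> R) : Prop :=
  feasible M pi /\
  forall pi', feasible M pi' ->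
    cost_value M pi (xinit M) <= cost_value M pi' (xinit M).

(* T_{pi,h}[V](x), as a function of the action distribution p = pi(.|x), the
   only part of pi it depends on. *)
Definition bellman (R : realType) (X A : finType) (M : cmdp R X A)
    (p : A -> R) (h : X -> A -> R) (V : X -> R) (x : X) : R :=
  \sum_(a : A) p a * (h x a + \sum_(y | y != xterm M) trans M x a y * V y).

Definition tv_dist (R : realType) (A : finType) (p q : A -> R) : R :=
  2^-1 * \sum_(a : A) `|q a - p a|.

Definition aux_cost (R : realType) (X A : finType) (M : cmdp R X A)
    (Tbar : R) (piB pistar : X -> A -> R) (x : X) : R :=
  2 * Tbar * Dmax M * tv_dist (pistar x) (piB x).

Definition lyapunov (R : realType) (X A : finType) (M : cmdp R X A)
    (Tbar : R) (piB pistar : X -> A -> R) (x : X) : R :=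
  if x == xterm M then 0
  else value M piB (fun y _ => ccost M y + aux_cost M Tbar piB pistar y) x.

(* The quantities maximized here and in [max_aux_cost] are nonnegative and
   there is a transient state, so the default value 0 of the finite maxima
   plays no role; [sup] is the maximum over the compact set of policies. *)
Definition max_constraint_value (R : realType) (X A : finType)
    (M : cmdp R X A) : R :=
  \big[Num.max/0]_(x | x != xterm M)
    sup [set constraint_value M pi x | pi in @policies R X A].

Definition max_aux_cost (R : realType) (X A : finType) (M : cmdp R X A)
    (Tbar : R) (piB pistar : X -> A -> R) : R :=
  \big[Num.max/0]_(x | x != xterm M) aux_cost M Tbar piB pistar x.

(* F_L(x), a set of action distributions. *)
Definition induced_actions (R : realType) (X A : finType) (M : cmdp R X A)
    (L : X -> R) (x : X) : set (A -> R) :=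
  [set p | is_dist p /\ bellman M p (fun y _ => ccost M y) L x <= L x].

(* Main.v *)
Require Import Defs.
From HB Require Import structures.
From mathcomp Require Import all_boot all_order all_algebra.
From mathcomp Require Import all_classical all_reals all_analysis.
From mathcomp Require Import lra.
Set Implicit Arguments.
Unset Strict Implicit.
Unset Printing Implicit Defensive.
Import Order.TTheory GRing.Theory Num.Theory.
Import numFieldNormedType.Exports.
Local Open Scope classical_set_scope.
Local Open Scope ring_scope.

(** The truncated returns of a nonnegative cost obey the Bellman recursion, are
    nondecreasing in the horizon and are bounded by [Tbar] times the cost, so
    the value is their limit and is a fixed point of the Bellman operator.
    If [0 <= Q <= K] then [\sum_a (p a - q a) * Q a <= K * TV(p, q)].  With
    [K = Tbar * Dmax], induction on the horizon gives [D_{pi*} <= L].  The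
    hypothesis forces [eps* <= Dmax], hence [L <= 2 * Tbar * Dmax]; taking this
    bound as [K], replacing [piB] by [pi*] in the fixed-point equation of [L]
    costs at most [eps*], so [pi*] itself lies in the induced set. *)

(** * Tuple sums and total variation *)

Lemma sum_tuple_cons (V : nmodType) (T : finType) (n : nat)
    (F : n.+1.-tuple T -> V) :
  \sum_w F w = \sum_(x : T) \sum_(w : n.-tuple T) F (cons_tuple x w).
Proof.
rewrite pair_big /=.
rewrite (reindex (fun p : T * n.-tuple T => cons_tuple p.1 p.2)) //=.
exists (fun w : n.+1.-tuple T => (thead w, behead_tuple w)) => [[x w] _|w _] /=.
  by congr (_, _); apply/val_inj.
by rewrite [RHS]tuple_eta; apply/val_inj.
Qed.

(** Bounding [|Q|] by [K] directly would give [2 * K] times the total variation; the factor saved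
    makes the later penalty match [aux_cost]. *)
Lemma sum_diff_le_tv_dist (R : realType) (A : finType) (p q Q : A -> R) (K : R) :
  is_dist p -> is_dist q -> (forall a, 0 <= Q a <= K) ->
  \sum_a p a * Q a <= \sum_a q a * Q a + K * tv_dist p q.
Proof.
move=> [_ p1] [_ q1] Q_bnd; rewrite -lerBlDl -sumrB.
(* Both masses are 1, so [Q] may be recentred at [K / 2]. *)
have -> : \sum_a (p a * Q a - q a * Q a)
          = \sum_a (p a - q a) * (Q a - K / 2).
  under [RHS]eq_bigr => a _ do rewrite mulrBr mulrBl.
  by rewrite [RHS]sumrB -mulr_suml [X in X * _]sumrB p1 q1 subrr mul0r subr0.
rewrite /tv_dist mulrA mulr_sumr ler_sum // => a _.
apply: le_trans (ler_norm _) _; rewrite normrM distrC mulrC.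
apply: ler_wpM2r => //; rewrite ler_norml.
by have /andP[? ?] := Q_bnd a; apply/andP; split; lra.
Qed.

(** * Trajectories and the Bellman recursion for truncated returns *)

Section Return.
Context (R : realType) (X A : finType) (M : cmdp R X A).
Implicit Types (pi : X -> A -> R) (h g : X -> A -> R) (V W : X -> R).

Lemma tv_dist_ge0 (p q : A -> R) : 0 <= tv_dist p q.
Proof. by rewrite mulr_ge0 ?invr_ge0 // sumr_ge0. Qed.

Lemma trans_ge0 x a y : 0 <= trans M x a y.
Proof. by case: (trans_dist M x a). Qed.

(** The two sides give [nth] different default states, [x] and [y]; the bound on [t] keeps the index
    in range. *)
Lemma state_at_cons x a y n (w : n.-tuple (A * X)) t : (t <= n)%N ->
  state_at x (cons_tuple (a, y) w) t.+1 = state_at y w t.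
Proof.
move=> tn; rewrite /state_at /=; apply: set_nth_default.
by rewrite /= size_map size_tuple.
Qed.

Lemma hitting_time_cons x a y n (w : n.-tuple (A * X)) : x != xterm M ->
  hitting_time M x (cons_tuple (a, y) w) = (hitting_time M y w).+1.
Proof. by rewrite /hitting_time /= => /negPf ->. Qed.

(** Allows bounds on costs to be assumed at transient states only, as is the case for the maximum of
    [aux_cost]. *)
Lemma state_at_transient x n (w : n.-tuple (A * X)) t :
  (t < hitting_time M x w)%N -> state_at x w t != xterm M.
Proof. by move=> /(before_find x) /= ->. Qed.

Lemma traj_prob_cons pi x a y n (w : n.-tuple (A * X)) :
  traj_prob M pi x (cons_tuple (a, y) w)
  = pi x a * trans M x a y * traj_prob M pi y w.
Proof.
rewrite /traj_prob big_ord_recl tnth0; congr (_ * _).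
apply: eq_bigr => t _; rewrite tnthS.
by rewrite -(state_at_cons x a y w (ltnW (ltn_ord t))).
Qed.

Lemma traj_expect_cons pi x n (f : n.+1.-tuple (A * X) -> R) :
  traj_expect M pi x f
  = \sum_a \sum_y pi x a * trans M x a y
      * traj_expect M pi y (fun w => f (cons_tuple (a, y) w)).
Proof.
rewrite /traj_expect sum_tuple_cons [RHS]pair_big /=.
apply: eq_bigr => -[a y] _ /=; rewrite mulr_sumr.
by apply: eq_bigr => w _; rewrite traj_prob_cons mulrA.
Qed.

Lemma traj_prob_ge0 pi x n (w : n.-tuple (A * X)) :
  policies pi -> 0 <= traj_prob M pi x w.
Proof.
move=> pi_pol; apply: prodr_ge0 => t _; rewrite mulr_ge0 ?trans_ge0 //.
by case: (pi_pol (state_at x w t)).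
Qed.

Lemma traj_expect_cst pi x n (k : R) : policies pi ->
  traj_expect M pi x (fun _ : n.-tuple (A * X) => k) = k.
Proof.
move=> pi_pol; elim: n x => [|n IH] x.
  rewrite /traj_expect (big_pred1 [tuple]) => [|w]; last first.
    by rewrite (tuple0 w) /= eq_refl.
  by rewrite /traj_prob big_ord0 mul1r.
rewrite traj_expect_cons.
under eq_bigr => a _.
  under eq_bigr => y _ do rewrite IH.
  rewrite -mulr_suml -mulr_sumr (trans_dist M x a).2 mulr1.
  over.
by rewrite -mulr_suml (pi_pol x).2 mul1r.
Qed.

Lemma truncated_return0 pi h x : truncated_return M pi h x 0 = 0.
Proof.
rewrite /truncated_return /traj_expect big1 // => w _.
by rewrite big_ord0 mulr0.
Qed.

Lemma truncated_return_xterm pi h n :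
  truncated_return M pi h (xterm M) n = 0.
Proof.
rewrite /truncated_return /traj_expect big1 // => w _.
by rewrite big1 ?mulr0 // => t; rewrite /hitting_time /= eqxx ltn0.
Qed.

Lemma truncated_returnS pi h x n : policies pi -> x != xterm M ->
  truncated_return M pi h x n.+1
  = bellman M (pi x) h (fun y => truncated_return M pi h y n) x.
Proof.
move=> pi_pol xT; rewrite {1}/truncated_return traj_expect_cons /bellman.
apply: eq_bigr => a _.
transitivity (\sum_y pi x a * trans M x a y
                * (h x a + truncated_return M pi h y n)).
  apply: eq_bigr => y _; congr (_ * _).
  (* Written as an expectation, the immediate cost merges with the return into one sum over [w]. *)
  rewrite -[in RHS](traj_expect_cst y n (h x a) pi_pol).
  rewrite /truncated_return /traj_expect -big_split /=.
  apply: eq_bigr => w _; rewrite -mulrDr; congr (_ * _).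
  rewrite big_mkcond big_ord_recl hitting_time_cons //=.
  congr (_ + _); rewrite [RHS]big_mkcond; apply: eq_bigr => t _.
  by rewrite tnthS -(state_at_cons x a y w (ltnW (ltn_ord t))).
under eq_bigr => y _ do rewrite -mulrA mulrDr.
rewrite -mulr_sumr big_split /= -mulr_suml (trans_dist M x a).2 mul1r.
(* The return from [xterm] vanishes, which leaves the transient successors that [bellman] sums
   over. *)
congr (_ * (_ + _)); rewrite (bigID (fun y => y == xterm M)) /=.
by rewrite big_pred1_eq truncated_return_xterm mulr0 add0r.
Qed.

Lemma ler_bellman (p : A -> R) h g V W x : is_dist p ->
  (forall a, h x a <= g x a) ->
  (forall y, y != xterm M -> V y <= W y) ->
  bellman M p h V x <= bellman M p g W x.
Proof.
move=> [p_ge0 _] hg VW; apply: ler_sum => a _; apply: ler_wpM2l => //.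
apply: lerD => //; apply: ler_sum => y yT.
by apply: ler_wpM2l; [exact: trans_ge0 | exact: VW].
Qed.

Lemma truncated_return_ge0 pi h x n : policies pi ->
  (forall y a, y != xterm M -> 0 <= h y a) -> 0 <= truncated_return M pi h x n.
Proof.
move=> pi_pol h_ge0; apply: sumr_ge0 => w _.
rewrite mulr_ge0 ?traj_prob_ge0 // sumr_ge0 // => t /state_at_transient tT.
exact: h_ge0.
Qed.

(** Nonnegativity starts an induction on the horizon, and monotonicity of [bellman] carries it
    on. *)
Lemma nondecreasing_truncated_return pi h x : policies pi ->
  (forall y a, y != xterm M -> 0 <= h y a) ->
  nondecreasing_seq (truncated_return M pi h x).
Proof.
move=> pi_pol h_ge0; apply/nondecreasing_seqP => n.
elim: n x => [|n IH] x.
  by rewrite truncated_return0 truncated_return_ge0.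
have [->|xT] := eqVneq x (xterm M); first by rewrite !truncated_return_xterm.
by rewrite !truncated_returnS //; apply: ler_bellman.
Qed.

(** As [h] ignores the action, changing [p] into [q] affects only the expected continuation [Q],
    which lies in [[0, K]]; the surplus of [g] over [h] pays for it. *)
Lemma bellman_diff_le (p q : A -> R) h g V x (K : R) :
  is_dist p -> is_dist q ->
  (forall a a', h x a = h x a') ->
  (forall a, h x a + K * tv_dist p q <= g x a) ->
  (forall y, y != xterm M -> 0 <= V y <= K) -> 0 <= K ->
  bellman M p h V x <= bellman M q g V x.
Proof.
move=> p_dist q_dist h_cst hg V_bnd K_ge0.
pose Q a := \sum_(y | y != xterm M) trans M x a y * V y.
have Q_bnd a : 0 <= Q a <= K.
  apply/andP; split.
    by apply: sumr_ge0 => y /V_bnd/andP[? _]; rewrite mulr_ge0 ?trans_ge0.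
  have -> : K = \sum_y trans M x a y * K.
    by rewrite -mulr_suml (trans_dist M x a).2 mul1r.
  rewrite /Q big_mkcond; apply: ler_sum => y _.
  case: ifP => [/V_bnd/andP[_ ?]|_]; last by rewrite mulr_ge0 ?trans_ge0.
  by rewrite ler_wpM2l ?trans_ge0.
have tv_le := sum_diff_le_tv_dist p_dist q_dist Q_bnd.
have [a0 _ | A0] := pickP (@predT A); last first.
  by rewrite /bellman !big_pred0.
have sum_cst (s : A -> R) (k : R) : is_dist s ->
    \sum_a s a * (k + Q a) = k + \sum_a s a * Q a.
  case=> _ s1; under eq_bigr => a _ do rewrite mulrDr.
  by rewrite big_split /= -mulr_suml s1 mul1r.
apply: (@le_trans _ _ (h x a0 + \sum_a p a * Q a)).
  rewrite -sum_cst //; apply: ler_sum => a _.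
  by rewrite (h_cst a a0).
apply: (@le_trans _ _ (h x a0 + K * tv_dist p q + \sum_a q a * Q a)); first lra.
rewrite -sum_cst //; apply: ler_sum => a _.
apply: ler_wpM2l; first by case: q_dist.
by rewrite lerD2r (h_cst a0 a).
Qed.

(** * Bounds from transience and passage to the limit *)

Section Transient.
Context (Tbar : R).
Hypothesis htrans : transient_within M Tbar.

(** If [Tbar <= 0], transience would apply to the empty trajectory, which has probability 1 and
    hitting time 1. *)
Lemma transient_gt0 pi x : policies pi -> x != xterm M -> 0 < Tbar.
Proof.
move=> pi_pol xT; rewrite ltNge; apply/negP => T0.
have : (1 : R) <= Tbar.
  have := @htrans pi x 0 [tuple] pi_pol xT T0.
  by rewrite /traj_prob big_ord0 /hitting_time /= (negPf xT); apply.
by move=> /le_trans /(_ T0); rewrite ler10.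
Qed.

(** On a trajectory of positive probability the surcharge [k] is paid once per step before the
    hitting time, hence at most [Tbar] times; the others have weight 0. *)
Lemma truncated_return_le_add pi h g (k : R) x n : policies pi ->
  x != xterm M -> 0 <= k -> (forall y a, y != xterm M -> h y a <= g y a + k) ->
  Tbar <= n%:R ->
  truncated_return M pi h x n <= truncated_return M pi g x n + k * Tbar.
Proof.
move=> pi_pol xT k_ge0 hg Tn.
rewrite -[k * Tbar](traj_expect_cst x n _ pi_pol).
rewrite /truncated_return /traj_expect -big_split /=; apply: ler_sum => w _.
rewrite -mulrDr.
have := traj_prob_ge0 x w pi_pol; rewrite le_eqVlt => /predU1P[<-|w_gt0].
  by rewrite !mul0r.
apply: ler_wpM2l; first exact: ltW.
have HT := htrans pi_pol xT Tn w_gt0.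
apply: (@le_trans _ _ (\sum_(t < n | (t < hitting_time M x w)%N)
    (g (state_at x w t) (tnth w t).1 + k))).
  by apply: ler_sum => t /state_at_transient; exact: hg.
rewrite big_split lerD2l /= sumr_const -mulr_natr.
apply: ler_wpM2l => //; apply: le_trans HT; rewrite ler_nat.
rewrite cardE -[leqRHS](size_iota 0) -(size_map val); apply: uniq_leq_size.
  by rewrite map_inj_uniq ?enum_uniq //; exact: val_inj.
move=> t /mapP[s]; rewrite mem_enum => s_lt ->.
by rewrite mem_iota; exact: s_lt.
Qed.

Lemma truncated_return_le pi h (k : R) x n : policies pi ->
  x != xterm M -> (forall y a, y != xterm M -> 0 <= h y a <= k) -> 0 <= k ->
  truncated_return M pi h x n <= k * Tbar.
Proof.
move=> pi_pol xT h_bnd k_ge0.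
have h_ge0 y a : y != xterm M -> 0 <= h y a by move=> yT; case/andP: (h_bnd y a yT).
have T_ge0 := ltW (transient_gt0 pi_pol xT).
(* Monotonicity allows the horizon to grow past [Tbar], where the previous bound applies with
   [g = 0]. *)
pose m := maxn n (Num.bound Tbar).
apply: (@le_trans _ _ (truncated_return M pi h x m)).
  by apply: nondecreasing_truncated_return => //; exact: leq_maxl.
have Tm : Tbar <= m%:R.
  apply: (@le_trans _ _ (Num.bound Tbar)%:R); last by rewrite ler_nat leq_maxr.
  by apply: ltW; apply: archi_boundP.
apply: (le_trans (@truncated_return_le_add pi h (fun _ _ => 0) k x m pi_pol xT
  k_ge0 _ Tm)) => [y a yT|].
  by rewrite add0r; case/andP: (h_bnd y a yT).
rewrite /truncated_return /traj_expect.
rewrite [X in X + _]big1 ?add0r // => w _.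
by rewrite big1 ?mulr0.
Qed.

Section Bounded.
Context (h : X -> A -> R) (k : R).
Hypothesis h_bnd : forall y a, y != xterm M -> 0 <= h y a <= k.

Lemma cvg_truncated_return pi x : policies pi -> x != xterm M ->
  truncated_return M pi h x n @[n --> \oo] --> value M pi h x.
Proof.
move=> pi_pol xT; apply: nondecreasing_is_cvgn.
  apply: nondecreasing_truncated_return => // y a yT.
  by case/andP: (h_bnd a yT).
(* The bounds on [h] give this once an action exists; an empty [A] would contradict the unit mass of
   [pi x]. *)
have k_ge0 : 0 <= k.
  have [a _ | A0] := pickP (@predT A).
    by have /andP[h0 hk] := h_bnd a xT; exact: le_trans h0 hk.
  have := (pi_pol x).2; rewrite big_pred0 // => /eqP.
  by rewrite eq_sym oner_eq0.
exists (k * Tbar) => _ [n _ <-].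
exact: truncated_return_le.
Qed.

Lemma truncated_return_le_value pi x n : policies pi -> x != xterm M ->
  truncated_return M pi h x n <= value M pi h x.
Proof.
move=> pi_pol xT; apply: nondecreasing_cvgn_le.
  apply: nondecreasing_truncated_return => // y a yT.
  by case/andP: (h_bnd a yT).
by apply/cvg_ex; exists (value M pi h x); exact: cvg_truncated_return.
Qed.

Lemma value_ge0 pi x : policies pi -> x != xterm M -> 0 <= value M pi h x.
Proof.
by move=> pi_pol xT; rewrite -(truncated_return0 pi h x)
  truncated_return_le_value.
Qed.

Lemma value_le pi x : policies pi -> x != xterm M -> 0 <= k ->
  value M pi h x <= k * Tbar.
Proof.
move=> pi_pol xT k_ge0.
apply: limr_le.
  by apply/cvg_ex; exists (value M pi h x); exact: cvg_truncated_return.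
by apply: nearW => n; exact: truncated_return_le.
Qed.

(** The recursion passes to the limit because [bellman] is a finite sum of continuous terms. *)
Lemma value_bellman pi x : policies pi -> x != xterm M ->
  value M pi h x = bellman M (pi x) h (value M pi h) x.
Proof.
move=> pi_pol xT.
have cvgS : truncated_return M pi h x n.+1 @[n --> \oo] --> value M pi h x.
  by rewrite (@cvg_shiftS _ (truncated_return M pi h x));
     exact: cvg_truncated_return.
suff cvgB : truncated_return M pi h x n.+1 @[n --> \oo]
    --> bellman M (pi x) h (value M pi h) x by exact: cvg_unique cvgS cvgB.
rewrite (eq_cvg _ _ (fun n => truncated_returnS h n pi_pol xT)).
rewrite /bellman; apply: cvg_big => [|a _]; first exact: add_continuous.
apply: cvgMl_tmp; apply: cvgD; first exact: cvg_cst.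
apply: cvg_big => [|y yT]; first exact: add_continuous.
by apply: cvgMl_tmp; exact: cvg_truncated_return.
Qed.

End Bounded.

(** The constants [kh] and [kg] only ensure convergence. The case [k = 0] is monotonicity of the
    value. *)
Lemma value_le_add pi h g (k kh kg : R) x : policies pi -> x != xterm M ->
  (forall y a, y != xterm M -> 0 <= h y a <= kh) -> (forall y a, y != xterm M -> 0 <= g y a <= kg) ->
  0 <= k -> (forall y a, y != xterm M -> h y a <= g y a + k) ->
  value M pi h x <= value M pi g x + k * Tbar.
Proof.
move=> pi_pol xT h_bnd g_bnd k_ge0 hg.
rewrite {1}/value; apply: limr_le.
  by apply/cvg_ex; exists (value M pi h x); exact: cvg_truncated_return h_bnd _ _ _ _.
exists (Num.bound Tbar) => // n /= Tn.
apply: (le_trans (@truncated_return_le_add pi h g k x n pi_pol xT k_ge0 hg _)).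
  apply: (@le_trans _ _ (Num.bound Tbar)%:R); last by rewrite ler_nat.
  by apply: ltW; apply: archi_boundP; exact: ltW (transient_gt0 pi_pol xT).
by rewrite lerD2r; apply: truncated_return_le_value g_bnd _ _ _ _ _.
Qed.

End Transient.
End Return.

(** * Properties of the Lyapunov candidate *)

Theorem theorem1 (R : realType) (X A : finType) (M : cmdp R X A) (Tbar : R)
    (piB pistar : X -> A -> R)
    (htrans : transient_within M Tbar)
    (hB : feasible M piB)
    (hstar : optimal M pistar)
    (hbound :
       max_aux_cost M Tbar piB pistar <=
       Dmax M *
       Num.min ((threshold M - constraint_value M piB (xinit M))
                  / (Tbar * Dmax M))
               ((Tbar * Dmax M - max_constraint_value M)
                  / (Tbar * Dmax M + max_constraint_value M))) :
  let L := lyapunov M Tbar piB pistar in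
  let d := fun (x : X) (_ : A) => ccost M x in
  [/\ forall x, x != xterm M -> bellman M (piB x) d L x <= L x,
      forall x, x != xterm M ->
        0 <= Num.max (constraint_value M pistar x) (constraint_value M piB x)
          <= L x,
      forall x, x != xterm M -> bellman M (pistar x) d L x <= L x,
      L (xinit M) <= threshold M &
      exists pi, optimal M pi /\
        (forall x, x != xterm M -> induced_actions M L x (pi x))].
Proof.
move=> L d.
have [[piB_pol DB_le] [[pis_pol _] _]] := (hB, hstar).
pose e := aux_cost M Tbar piB pistar.
pose m := max_aux_cost M Tbar piB pistar.
pose de := fun (y : X) (_ : A) => ccost M y + e y.
have D_gt0 := Dmax_gt0 M.
have T_gt0 := transient_gt0 htrans piB_pol (xinit_transient M).
have TD_gt0 : 0 < Tbar * Dmax M by rewrite mulr_gt0.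
have e_ge0 y : 0 <= e y.
  by rewrite /e /aux_cost mulr_ge0 ?tv_dist_ge0 // mulr_ge0 ?ltW // mulr_gt0.
have e_le_m y : y != xterm M -> e y <= m by move=> yT; exact: le_bigmax_cond.
have m_ge0 : 0 <= m by exact: bigmax_ge_id.
(* The two entries of the minimum give one bound each; the second ratio is at most 1 since
   [max_constraint_value M] is nonnegative. *)
have [m_le1 m_le2] : m * Tbar <= threshold M - constraint_value M piB (xinit M)
    /\ m <= Dmax M.
  have Dbar_ge0 : 0 <= max_constraint_value M by exact: bigmax_ge_id.
  move: hbound; rewrite -/m (minr_pMr _ _ (ltW D_gt0)) le_min => /andP[m1 m2]; split.
    rewrite -ler_pdivlMr //; apply: le_trans m1 _.
    by rewrite mulrC -mulrA invfM -mulrA mulVf ?gt_eqF // mulr1.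
  apply: le_trans m2 _; apply: ler_piMr; first exact: ltW.
  by rewrite ler_pdivrMr ?mul1r; lra.
have d_bnd y (a : A) : y != xterm M -> 0 <= d y a <= Dmax M.
  by move=> _; exact: ccost_bounds.
have de_bnd y (a : A) : y != xterm M -> 0 <= de y a <= 2 * Dmax M.
  move=> yT; have := e_le_m y yT; have := e_ge0 y.
  by have := d_bnd y a yT; rewrite /d /de; lra.
have LE x : x != xterm M -> L x = value M piB de x.
  by rewrite /L /lyapunov => /negPf ->.
have L_fix x : x != xterm M -> L x = bellman M (piB x) de L x.
  move=> xT; rewrite LE // (value_bellman htrans de_bnd) //.
  (* [L] and the value are known to agree at transient states only, and [bellman] sees no others. *)
  apply: le_anti; apply/andP; split; apply: ler_bellman => // y yT;
  by rewrite LE.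
have L_bnd x : x != xterm M -> 0 <= L x <= 2 * Dmax M * Tbar.
  move=> xT; rewrite LE // (value_ge0 htrans de_bnd) //=.
  by apply: (value_le htrans de_bnd) => //; rewrite mulr_ge0 // ltW.
have item1 x : x != xterm M -> bellman M (piB x) d L x <= L x.
  move=> xT; rewrite [leRHS]L_fix //.
  by apply: ler_bellman => // a; rewrite /d /de lerDl.
have item3 x : x != xterm M -> bellman M (pistar x) d L x <= L x.
  move=> xT; rewrite [leRHS]L_fix //.
  (* With this [K] the penalty [K * tv_dist] equals [e x] exactly. *)
  apply: (bellman_diff_le (K := 2 * Dmax M * Tbar)) => //.
    by move=> a; rewrite /d /de /e /aux_cost; lra.
  by rewrite mulr_ge0 ?mulr_ge0 // ltW.
have Ds_le n x : x != xterm M ->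
    truncated_return M pistar d x n <= truncated_return M piB de x n.
  elim: n x => [|n IH] x xT; first by rewrite !truncated_return0.
  rewrite !truncated_returnS //.
  (* First the policy changes with the continuation fixed, at a penalty of half of [e x]; then the
     induction hypothesis raises the continuation. *)
  apply: (@le_trans _ _ (bellman M (piB x) de
            (fun y => truncated_return M pistar d y n) x)); last first.
    by apply: ler_bellman.
  apply: (bellman_diff_le (K := Dmax M * Tbar)) => //.
  - move=> a; rewrite /d /de lerD2l /e /aux_cost.
    have := tv_dist_ge0 (pistar x) (piB x).
    by move: (tv_dist _ _) => t t_ge0; rewrite [2 * _]mulrC; nra.
  - move=> y yT; rewrite truncated_return_ge0 //=; last first.
      by move=> z a zT; case/andP: (d_bnd z a zT).
    by apply: (truncated_return_le htrans) => //; exact: ltW.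
  - by rewrite mulr_ge0 // ltW.
split=> // [x xT||].
- have Ds_ge0 : 0 <= constraint_value M pistar x.
    exact: (value_ge0 htrans d_bnd).
  rewrite le_max Ds_ge0 /= ge_max; apply/andP; split.
    rewrite LE //; apply: limr_le.
      apply/cvg_ex; exists (value M pistar d x).
      exact: (cvg_truncated_return htrans d_bnd).
    apply: nearW => n; apply: le_trans (Ds_le n x xT) _.
    exact: (truncated_return_le_value htrans de_bnd).
  rewrite LE // -[leRHS]addr0 -(mul0r Tbar).
  apply: (value_le_add htrans piB_pol xT d_bnd de_bnd) => // y a _.
  by rewrite addr0 /d /de lerDl.
(* Since [e <= m], [L] exceeds the constraint value of [piB] by at most [m * Tbar], the slack that
   [m_le1] provides. *)
- rewrite LE ?xinit_transient //.
  have := @value_le_add _ _ _ _ _ htrans piB de d m _ _ _ piB_pol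
    (xinit_transient M) de_bnd d_bnd m_ge0.
  have : forall y (a : A), y != xterm M -> de y a <= d y a + m.
    by move=> y a yT; rewrite /de /d lerD2l e_le_m.
  move=> H /(_ H); rewrite -/d; move: m_le1; rewrite /constraint_value -/d.
  lra.
- by exists pistar; split=> // x xT; split; [exact: pis_pol | exact: item3].
Qed.
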